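(* Let $\Gamma=(V,a)$ be an AC network with $a=c-ib$, let $m\ge 1$ be an integer, and let $\bm u=(u_1,\dots,u_m)$ and $\bm s=(s_1,\dots,s_m)$ be elements of $\mathcal{C}(V,\mathbb{C}^m)$. Let $\epsilon>0$. If $\Gamma'$ is an AC network that is an $\epsilon$-approximation of $\Gamma$, then $$\mathrm{rms}(\Gamma',\bm u,\bm s)\;\le\;\mathrm{rms}(\Gamma,\bm u,\bm s)+\epsilon\,\frac{\Delta(\Gamma,\bm u)}{\sqrt{2m|V|}},$$ where $\Delta(\Gamma,\bm u)$, which depends only on $\Gamma$ and $\bm u$, is given by $$\Delta(\Gamma,\bm u)=\left(A^2+B^2\right)^{1/2},$$ $$A=\sqrt{m|V|}\left(\|\mathcal{Q}_{\Gamma_c,\Re(\bm u)}\|_2+\|\mathcal{Q}_{\Gamma_c,\Im(\bm u)}\|_2\right)+\|\mathcal{L}_b\|_2\left(\|\Re(\bm u)\|_\infty\|\Im(\bm u)\|_2+\|\Im(\bm u)\|_\infty\|\Re(\bm u)\|_2\right),$$ $$B=\sqrt{m|V|}\left(\|\mathcal{Q}_{\Gamma_b,\Re(\bm u)}\|_2+\|\mathcal{Q}_{\Gamma_b,\Im(\bm u)}\|_2\right)+\|\mathcal{L}_c\|_2\left(\|\Im(\bm u)\|_\infty\|\Re(\bm u)\|_2+\|\Re(\bm u)\|_\infty\|\Im(\bm u)\|_2\right).$$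
   Context: Let $V$ be a finite nonempty set. For $K=\mathbb{R}$ or $\mathbb{C}$, $\mathcal{C}(V,K^m)$ is the space of functions $V\to K^m$, with components $\bm u=(u_1,\dots,u_m)$; $\mathcal{C}(V)=\mathcal{C}(V,\mathbb{R})$. Real parts, imaginary parts and complex conjugates are taken componentwise and pointwise: $\Re(\bm u)=(\Re(u_1),\dots,\Re(u_m))$, $\Im(\bm u)=(\Im(u_1),\dots,\Im(u_m))$, both in $\mathcal{C}(V,\mathbb{R}^m)$. Products of scalar functions are pointwise, and $\int_V u\,dx=\sum_{x\in V}u(x)$. The inner product is $\langle\bm u,\bm v\rangle=\sum_{j=1}^m\int_V u_j\overline{v_j}\,dx$, with associated norm $\|\cdot\|_2$; for a linear operator, $\|\cdot\|_2$ is the induced operator (spectral) norm. Also $\|\bm u\|_\infty=\max_{j}\max_{x\in V}|u_j(x)|$. A DC network is a pair $(V,c)$ where $c:V\times V\to[0,\infty)$ is symmetric and $c(x,x)=0$ for all $x\in V$. An AC network is a pair $\Gamma=(V,a)$ where $a:V\times V\to\mathbb{C}$ has the form $a=c-ib$ with $c,b:V\times V\to[0,\infty)$ symmetric and $c(x,x)=b(x,x)=0$ for all $x\in V$. The DC networks $\Gamma_c=(V,c)$ and $\Gamma_b=(V,b)$ are called the conductance and susceptance networks of $\Gamma$. For symmetric $a:V\times V\to\mathbb{C}$ vanishing on the diagonal, the Laplacian $\mathcal{L}_a$ is the linear operator on $\mathcal{C}(V,\mathbb{C})$ given by $\mathcal{L}_a(u)(x)=\sum_{y\in V}a(x,y)(u(x)-u(y))$;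 for real $a$ it restricts to an operator on $\mathcal{C}(V)$. The energy of a DC network $(V,c)$ is $\mathcal{E}(u,v)=\int_V u\,\mathcal{L}_c(v)\,dx$ for $u,v\in\mathcal{C}(V)$. For $\epsilon>0$, a DC network $(V,c')$ with energy $\mathcal{E}'$ is an $\epsilon$-approximation of a DC network $(V,c)$ with energy $\mathcal{E}$ if for all $u\in\mathcal{C}(V)$: $\frac{1}{1+\epsilon}\mathcal{E}(u,u)\le\mathcal{E}'(u,u)\le(1+\epsilon)\mathcal{E}(u,u)$. An AC network $\Gamma'$ (on the same vertex set $V$) is an $\epsilon$-approximation of an AC network $\Gamma$ if the conductance and susceptance networks of $\Gamma'$ are $\epsilon$-approximations of the conductance and susceptance networks of $\Gamma$, respectively. The error of an AC network $\Gamma=(V,a)$ in the data pair $(\bm u,\bm s)$ is $$\mathrm{rms}(\Gamma,\bm u,\bm s)=\sqrt{\frac{1}{2m|V|}\sum_{j=1}^m\int_V\left|u_j\overline{\mathcal{L}_a(u_j)}-s_j\right|^2dx}.$$ For a DC network $\Gamma_0=(V,c_0)$ and $\bm w=(w_1,\dots,w_m)\in\mathcal{C}(V,\mathbb{R}^m)$, $\mathcal{Q}_{\Gamma_0,\bm w}$ is the linear operator on $\mathcal{C}(V,\mathbb{R}^m)$ defined by $\mathcal{Q}_{\Gamma_0,\bm w}(v_1,\dots,v_m)=\left(w_1\mathcal{L}_{c_0}(w_1v_1),\dots,w_m\mathcal{L}_{c_0}(w_mv_m)\right)$. *)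

(* Defs.v *)
From HB Require Import structures.
From mathcomp Require Import all_boot all_order all_algebra.
From mathcomp Require Import classical_sets reals.
From mathcomp Require Import complex.

Set Implicit Arguments.
Unset Strict Implicit.
Unset Printing Implicit Defensive.

Import Order.TTheory GRing.Theory Num.Theory.

Local Open Scope ring_scope.
Local Open Scope complex_scope.
Local Open Scope classical_set_scope.

(* [K^o] is [K] seen as a module over itself, so that both function spaces
   are left [K]-modules. *)
Notation scalar_fun V K := {ffun V -> K^o}.
Notation vector_fun V K m := {ffun V -> 'rV[K]_m}.

Definition component (V : finType) (K : pzRingType) (m : nat)
    (u : vector_fun V K m) (j : 'I_m) : scalar_fun V K :=
  [ffun x => u x 0 j].

Definition pmul (V : finType) (K : pzRingType) (f g : scalar_fun V K) :
    scalar_fun V K :=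
  [ffun x => f x * g x].

Definition re_fun (R : realType) (V : finType) (m : nat)
    (u : vector_fun V R[i] m) : vector_fun V R m :=
  [ffun x => map_mx (@complex.Re R) (u x)].

Definition im_fun (R : realType) (V : finType) (m : nat)
    (u : vector_fun V R[i] m) : vector_fun V R m :=
  [ffun x => map_mx (@complex.Im R) (u x)].

Definition inner_cplx (R : realType) (V : finType)
    (f g : scalar_fun V R[i]) : R[i] :=
  \sum_(x : V) f x * conjc (g x).

(* [inner_cplx f f] is real, so taking its real part loses nothing. *)
Definition norm2_cplx (R : realType) (V : finType)
    (f : scalar_fun V R[i]) : R :=
  Num.sqrt (complex.Re (inner_cplx f f)).

Definition inner_real (R : realType) (V : finType) (m : nat)
    (v w : vector_fun V R m) : R :=
  \sum_(j < m) \sum_(x : V) component v j x * component w j x.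

Definition norm2_real (R : realType) (V : finType) (m : nat)
    (v : vector_fun V R m) : R :=
  Num.sqrt (inner_real v v).

Definition norm_inf (R : realType) (V : finType) (m : nat)
    (v : vector_fun V R m) : R :=
  \big[Num.max/0]_(j < m) \big[Num.max/0]_(x : V) `|component v j x|.

Definition op_norm (R : realType) (K : pzRingType) (E : lmodType K)
    (N : E -> R) (T : {linear E -> E}) : R :=
  sup [set N (T v) | v in [set v | N v <= 1]].

Record dc_network (R : realType) (V : finType) := DCNetwork {
  weight :> V -> V -> R;
  weight_ge0 : forall x y, 0 <= weight x y;
  weight_sym : forall x y, weight x y = weight y x;
  weight_diag : forall x, weight x x = 0
}.

(* An AC network [a = c - ib] is given by its conductance network [c] and its
   susceptance network [b], which [a] determines uniquely. *)
Record ac_network (R : realType) (V : finType) := ACNetwork {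
  conductance : dc_network R V;
  susceptance : dc_network R V
}.

Definition admittance (R : realType) (V : finType) (G : ac_network R V) :
    V -> V -> R[i] :=
  fun x y => (conductance G x y -i* susceptance G x y)%C.

Definition laplacian (V : finType) (K : comPzRingType) (a : V -> V -> K)
    (f : scalar_fun V K) : scalar_fun V K :=
  [ffun x => \sum_(y : V) a x y * (f x - f y)].

Fact laplacian_is_linear (V : finType) (K : comPzRingType) (a : V -> V -> K) :
  linear (laplacian a).
Proof.
move=> k f g; apply/ffunP => x; rewrite !ffunE scaler_sumr -big_split /=.
apply: eq_bigr => y _; rewrite !ffunE.
rewrite opprD addrACA -scalerBr mulrDr; congr (_ + _).
exact: mulrCA.
Qed.

HB.instance Definition _ (V : finType) (K : comPzRingType) (a : V -> V -> K) :=
  GRing.isLinear.Build K (scalar_fun V K) (scalar_fun V K) _ (laplacian a)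
    (laplacian_is_linear a).

(* The Laplacian of a DC network, acting on complex functions. *)
Definition cplx_laplacian (R : realType) (V : finType) (G : dc_network R V) :
    {linear scalar_fun V R[i] -> scalar_fun V R[i]} :=
  laplacian (fun x y => (G x y)%:C).

Definition energy (R : realType) (V : finType) (G : dc_network R V)
    (f g : scalar_fun V R) : R :=
  \sum_(x : V) f x * laplacian G g x.

Definition dc_approx (R : realType) (V : finType) (eps : R)
    (G' G : dc_network R V) : Prop :=
  forall f : scalar_fun V R,
    1 / (1 + eps) * energy G f f <= energy G' f f /\
    energy G' f f <= (1 + eps) * energy G f f.

Definition ac_approx (R : realType) (V : finType) (eps : R)
    (G' G : ac_network R V) : Prop :=
  dc_approx eps (conductance G') (conductance G) /\
  dc_approx eps (susceptance G') (susceptance G).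

Definition rms (R : realType) (V : finType) (m : nat) (G : ac_network R V)
    (u s : vector_fun V R[i] m) : R :=
  Num.sqrt ((2 * m%:R * #|V|%:R)^-1 *
    \sum_(j < m) \sum_(x : V)
      ComplexField.Normc.normc
        (component u j x * conjc (laplacian (admittance G) (component u j) x)
         - component s j x) ^+ 2).

Definition Qop (R : realType) (V : finType) (m : nat) (G : dc_network R V)
    (w v : vector_fun V R m) : vector_fun V R m :=
  [ffun x => \row_(j < m)
     pmul (component w j)
       (laplacian G (pmul (component w j) (component v j))) x].

Fact Qop_is_linear (R : realType) (V : finType) (m : nat) (G : dc_network R V)
    (w : vector_fun V R m) :
  linear (Qop G w).
Proof.
move=> k f g; apply/ffunP => x; apply/rowP => j.
have E : pmul (component w j) (component (k *: f + g) j) =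
    k *: pmul (component w j) (component f j)
    + pmul (component w j) (component g j).
  apply/ffunP => y; rewrite !ffunE !mxE mulrDr; congr (_ + _).
  exact: mulrCA.
have QE v : Qop G w v x 0 j = component w j x
    * laplacian G (pmul (component w j) (component v j)) x.
  by rewrite /Qop ffunE mxE {1}/pmul ffunE.
rewrite QE E laplacian_is_linear [X in _ * X]ffunE mulrDr.
rewrite [in RHS]ffunE mxE -QE; congr (_ + _).
rewrite [in RHS]ffunE mxE QE [X in _ * X]ffunE.
exact: mulrCA.
Qed.

HB.instance Definition _ (R : realType) (V : finType) (m : nat)
    (G : dc_network R V) (w : vector_fun V R m) :=
  GRing.isLinear.Build R (vector_fun V R m) (vector_fun V R m) _ (Qop G w)
    (Qop_is_linear G w).

Definition normQ (R : realType) (V : finType) (m : nat) (G : dc_network R V)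
    (w : vector_fun V R m) : R :=
  op_norm (@norm2_real R V m) (Qop G w).

Definition normL (R : realType) (V : finType) (G : dc_network R V) : R :=
  op_norm (@norm2_cplx R V) (cplx_laplacian G).

Definition DeltaA (R : realType) (V : finType) (m : nat) (G : ac_network R V)
    (u : vector_fun V R[i] m) : R :=
  Num.sqrt (m%:R * #|V|%:R) *
    (normQ (conductance G) (re_fun u) + normQ (conductance G) (im_fun u)) +
  normL (susceptance G) *
    (norm_inf (re_fun u) * norm2_real (im_fun u) +
     norm_inf (im_fun u) * norm2_real (re_fun u)).

Definition DeltaB (R : realType) (V : finType) (m : nat) (G : ac_network R V)
    (u : vector_fun V R[i] m) : R :=
  Num.sqrt (m%:R * #|V|%:R) *
    (normQ (susceptance G) (re_fun u) + normQ (susceptance G) (im_fun u)) +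
  normL (conductance G) *
    (norm_inf (im_fun u) * norm2_real (re_fun u) +
     norm_inf (re_fun u) * norm2_real (im_fun u)).

Definition Delta (R : realType) (V : finType) (m : nat) (G : ac_network R V)
    (u : vector_fun V R[i] m) : R :=
  Num.sqrt (DeltaA G u ^+ 2 + DeltaB G u ^+ 2).

(* Main.v *)
(* Each entry of [u_j conj(L_a u_j)] has real part
   [p L_c p + q L_c q + p L_b q - q L_b p] and imaginary part
   [q L_c p - p L_c q + q L_b q + p L_b p], where [u_j = p + i q].  By the
   triangle inequality it suffices to bound the change of every term when
   [(c, b)] becomes [(c', b')].  Since [-eps E <= E' - E <= eps E] as quadratic
   forms, symmetry of the operators gives
   [|T' - T| <= eps |T|] for [T = L_c], [L_b] and for [T = Q_{c,w}], [Q_{b,w}].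
   The terms [w L w] are [Q_w] applied to the constant function 1, whose norm is
   [sqrt (m |V|)]; in the cross terms one factor is estimated in sup norm. *)
Require Import Defs.
From mathcomp Require Import all_boot all_order all_algebra.
From mathcomp Require Import classical_sets reals.
From mathcomp Require Import complex.
From mathcomp Require Import ring lra.

Import Order.TTheory GRing.Theory Num.Theory.
Local Open Scope ring_scope.
Local Open Scope complex_scope.

(** * Symmetric bilinear forms and operators on an inner product space *)

Definition sym_bilinear {R : rcfType} {E : lmodType R} (B : E -> E -> R) :=
  (forall x y, B x y = B y x) /\
  (forall a x y z, B (a *: x + y) z = a * B x z + B y z).

(** A predicate on forms, so that the same estimates serve [dot] on scalar functions and
    [inner_real] on vector functions. *)
Definition inner_product {R : rcfType} {E : lmodType R} (ip : E -> E -> R) :=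
  [/\ sym_bilinear ip, forall x, 0 <= ip x x & forall x, ip x x = 0 -> x = 0].

Definition ip_norm {R : rcfType} {E : lmodType R} (ip : E -> E -> R) (x : E) :=
  Num.sqrt (ip x x).

Section SymBilinear.
Context {R : rcfType} {E : lmodType R} {B : E -> E -> R}.
Hypothesis B_bil : sym_bilinear B.

Lemma bilDl x y z : B (x + y) z = B x z + B y z.
Proof. by rewrite -[x in LHS]scale1r B_bil.2 mul1r. Qed.

Lemma bil0l z : B 0 z = 0.
Proof. by apply: (addrI (B 0 z)); rewrite -bilDl !addr0. Qed.

Lemma bilZl a x z : B (a *: x) z = a * B x z.
Proof. by rewrite -[a *: x]addr0 B_bil.2 bil0l addr0. Qed.

Lemma bilBl x y z : B (x - y) z = B x z - B y z.
Proof. by rewrite -scaleN1r bilDl bilZl mulN1r. Qed.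

Lemma bilDr x y z : B z (x + y) = B z x + B z y.
Proof. by rewrite !(B_bil.1 z) bilDl. Qed.

Lemma bilZr a x z : B z (a *: x) = a * B z x.
Proof. by rewrite !(B_bil.1 z) bilZl. Qed.

Lemma bilBr x y z : B z (x - y) = B z x - B z y.
Proof. by rewrite !(B_bil.1 z) bilBl. Qed.

End SymBilinear.

Section InnerProduct.
Context {R : rcfType} {E : lmodType R} {ip : E -> E -> R}.
Hypothesis ipP : inner_product ip.
Let ip_bil : sym_bilinear ip := let: And3 h _ _ := ipP in h.
Local Notation N := (ip_norm ip).

Lemma ip_norm_ge0 x : 0 <= N x.
Proof. exact: sqrtr_ge0. Qed.

Lemma sqr_ip_norm x : N x ^+ 2 = ip x x.
Proof. by rewrite sqr_sqrtr //; case: ipP. Qed.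

Lemma ip_norm_eq0 x : N x = 0 -> x = 0.
Proof. by case: ipP => _ _ + Nx0; apply; rewrite -sqr_ip_norm Nx0 expr0n. Qed.

Lemma ip_normZ a x : 0 <= a -> N (a *: x) = a * N x.
Proof.
move=> a0; rewrite /ip_norm (bilZl ip_bil) (bilZr ip_bil) mulrA -expr2.
by rewrite sqrtrM ?sqr_ge0 // sqrtr_sqr ger0_norm.
Qed.

(* Polarize at the rescaled vectors [N w *: v] and [N v *: w], which have the
   same norm. *)
Lemma form_bound (B : E -> E -> R) (K : R) : sym_bilinear B ->
  (forall v, `|B v v| <= K * ip v v) ->
  forall v w, `|B v w| <= K * N v * N w.
Proof.
move=> hB hK v w.
have [v0|v0] := eqVneq (N v) 0.
  by rewrite v0 mulr0 mul0r (ip_norm_eq0 _ v0) (bil0l hB) normr0.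
have [w0|w0] := eqVneq (N w) 0.
  by rewrite w0 mulr0 (ip_norm_eq0 _ w0) hB.1 (bil0l hB) normr0.
have a0 : 0 < N v by rewrite lt_neqAle eq_sym v0 ip_norm_ge0.
have b0 : 0 < N w by rewrite lt_neqAle eq_sym w0 ip_norm_ge0.
have := hK (N w *: v + N v *: w); have := hK (N w *: v - N v *: w).
rewrite !(bilBl hB, bilBr hB, bilDl hB, bilDr hB, bilZl hB, bilZr hB).
rewrite !(bilBl ip_bil, bilBr ip_bil, bilDl ip_bil, bilDr ip_bil,
  bilZl ip_bil, bilZr ip_bil) -!sqr_ip_norm (hB.1 w v) (ip_bil.1 w v).
rewrite !ler_norml; set a := N v; set b := N w.
move=> /andP[m1 m2] /andP[p1 p2].
(* The difference of the two forms is [4 * a * b * B v w], while by the parallelogram law the two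
   upper bounds add up to [4 * K * a ^+ 2 * b ^+ 2]; one factor [a * b] cancels. *)
have ab0 : 0 < a * b by rewrite mulr_gt0.
apply/andP; split; rewrite -(ler_pM2l ab0); lra.
Qed.

Lemma ip_normD x y : N (x + y) <= N x + N y.
Proof.
(* Cauchy-Schwarz is [form_bound] for the inner product itself, with constant 1. *)
have CS : `|ip x y| <= 1 * N x * N y.
  apply: form_bound => // v; rewrite mul1r ger0_norm //; by case: ipP.
have /ler_normlP[_ {}CS] := CS.
rewrite -(ler_pXn2r (n := 2)) ?nnegrE ?addr_ge0 ?ip_norm_ge0 //.
rewrite sqr_ip_norm !(bilDl ip_bil, bilDr ip_bil) -!sqr_ip_norm.
by rewrite (ip_bil.1 y x); nra.
Qed.

(** Taking [w = T v] in [form_bound] bounds [N (T v) ^+ 2] by [K * N v * N (T v)], and a factor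
    [N (T v)] cancels. Symmetry is essential: a quarter turn of the plane has zero quadratic
    form. *)
Lemma sym_op_bound (T : E -> E) (K : R) : 0 <= K ->
  sym_bilinear (fun v w => ip (T v) w) ->
  (forall v, `|ip (T v) v| <= K * ip v v) ->
  forall v, N (T v) <= K * N v.
Proof.
move=> K0 hT hK v.
have [->|n0] := eqVneq (N (T v)) 0; first by rewrite mulr_ge0 ?ip_norm_ge0.
have n_gt0 : 0 < N (T v) by rewrite lt_neqAle eq_sym n0 ip_norm_ge0.
rewrite -(ler_pM2r n_gt0) -expr2 sqr_ip_norm.
exact: le_trans (ler_norm _) (form_bound _ _ hT hK _ _).
Qed.

(** The quadratic form of [T - S] is at most [eps] times that of [S] in absolute value, and
    Cauchy-Schwarz bounds the latter by [K * ip v v]; [sym_op_bound] turns this form estimate into a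
    norm estimate. *)
Lemma approx_op_bound (S T : E -> E) (K eps : R) : 0 <= K -> 0 < eps ->
  sym_bilinear (fun v w => ip (S v) w) ->
  sym_bilinear (fun v w => ip (T v) w) ->
  (forall v, 0 <= ip (S v) v) ->
  (forall v, N (S v) <= K * N v) ->
  (forall v, 1 / (1 + eps) * ip (S v) v <= ip (T v) v /\
             ip (T v) v <= (1 + eps) * ip (S v) v) ->
  forall v, N (T v - S v) <= eps * K * N v.
Proof.
move=> K0 e0 hS hT S0 SK hST; apply: sym_op_bound.
- by rewrite mulr_ge0 // ltW.
- split=> [x y | a x y z]; rewrite !(bilBl ip_bil); first by rewrite hS.1 hT.1.
  by rewrite hS.2 hT.2; ring.
move=> v; have [l1 l2] := hST v; have S0v := S0 v.
have SKv : ip (S v) v <= K * ip v v.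
  have := form_bound ip 1 ip_bil _ (S v) v.
  rewrite mul1r => CS; apply: le_trans (ler_norm _) (le_trans (CS _) _).
    by move=> x; rewrite mul1r ger0_norm //; case: ipP.
  rewrite -sqr_ip_norm; apply: le_trans (ler_wpM2r (ip_norm_ge0 _) (SK v)) _.
  by rewrite expr2 mulrA.
(* Since [(1 - eps) * (1 + eps) <= 1], the lower approximation bound also loses at most [eps] times
   the form of [S]. *)
have e1 : 1 - eps <= 1 / (1 + eps) by rewrite ler_pdivlMr; nra.
have l3 := ler_wpM2r S0v e1.
have l4 := ler_wpM2l (ltW e0) SKv.
rewrite (bilBl ip_bil) -mulrA ler_norml; apply/andP; split; lra.
Qed.

End InnerProduct.

(** * Operator norms as suprema over the unit ball *)

(* [emb] lets real scalars act on [E] also when [K] is the complex field. *)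
Lemma op_norm_bound (R : realType) (K : pzRingType) (E : lmodType K)
    (emb : R -> K) (N : E -> R) (T : {linear E -> E}) (C : R) :
  (forall v, 0 <= N v) ->
  (forall r v, 0 <= r -> N (emb r *: v) = r * N v) ->
  (forall v, N v = 0 -> v = 0) -> N 0 = 0 ->
  (forall v, N (T v) <= C * N v) -> 0 <= C ->
  (0 <= op_norm N T) /\ (forall v, N (T v) <= op_norm N T * N v).
Proof.
move=> N0 NZ Neq0 N00 TC C0.
(* The a priori bound [C] makes the supremum genuine: on a set without upper bound, [sup] is only a
   default value. *)
have ub : has_ubound [set N (T v) | v in [set v | N v <= 1]].
  exists C => _ [v /= v1 <-]; apply: le_trans (TC v) _.
  by rewrite -[leRHS]mulr1 ler_wpM2l.
have le_op v : N v <= 1 -> N (T v) <= op_norm N T.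
  by move=> v1; apply: ub_le_sup => //; exists v.
split; first by have := le_op 0; rewrite linear0 N00; apply.
move=> v; have [v0|v0] := eqVneq (N v) 0.
  by rewrite (Neq0 _ v0) linear0 N00 mulr0.
have n_gt0 : 0 < N v by rewrite lt_neqAle eq_sym v0 N0.
have i0 : 0 <= (N v)^-1 by rewrite invr_ge0.
have := le_op (emb (N v)^-1 *: v); rewrite linearZ !NZ // mulVf // => /(_ (lexx _)).
by rewrite mulrC ler_pdivrMr.
Qed.

(** * The Euclidean inner products on scalar and vector functions *)

Definition dot {R : realType} {V : finType} (f g : scalar_fun V R) : R :=
  \sum_(x : V) f x * g x.

Lemma inner_product_dot (R : realType) (V : finType) :
  inner_product (@dot R V).
Proof.
split=> [|f|f /eqP]; first split=> [f g|a f g h].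
- by apply: eq_bigr => x _; rewrite mulrC.
- rewrite /dot mulr_sumr -big_split; apply: eq_bigr => x _ /=.
  by rewrite !ffunE mulrDl -mulrA.
- by apply: sumr_ge0 => x _; rewrite -expr2 sqr_ge0.
rewrite psumr_eq0 => [/allP f0|x _]; last by rewrite -expr2 sqr_ge0.
apply/ffunP => x; rewrite ffunE; apply/eqP.
by have := f0 x (mem_index_enum _); rewrite -expr2 sqrf_eq0.
Qed.

Lemma inner_real_dot (R : realType) (V : finType) (m : nat)
    (v w : vector_fun V R m) :
  inner_real v w = \sum_(j < m) dot (component v j) (component w j).
Proof. by []. Qed.

Lemma component_linear (R : realType) (V : finType) (m : nat) (a : R)
    (v w : vector_fun V R m) j :
  component (a *: v + w) j = a *: component v j + component w j.
Proof. by apply/ffunP => x; rewrite !ffunE !mxE. Qed.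

Lemma inner_product_inner_real (R : realType) (V : finType) (m : nat) :
  inner_product (@inner_real R V m).
Proof.
have [[dC dP] d0 deq0] := inner_product_dot R V.
split=> [|f|f /eqP]; first split=> [f g|a f g h].
- by rewrite !inner_real_dot; apply: eq_bigr => j _; rewrite dC.
- rewrite !inner_real_dot mulr_sumr -big_split; apply: eq_bigr => j _ /=.
  by rewrite component_linear dP.
- by rewrite inner_real_dot; apply: sumr_ge0 => j _.
rewrite inner_real_dot psumr_eq0 => [/allP f0|//].
apply/ffunP => x; apply/rowP => j; rewrite ffunE mxE.
have /eqP/deq0/ffunP/(_ x) := f0 j (mem_index_enum _).
by rewrite !ffunE.
Qed.

(** * The real Laplacian and its energy form *)

Section Laplacian.
Context {R : realType} {V : finType}.
Implicit Types (f g : scalar_fun V R) (G : dc_network R V).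

(** The form splits into a diagonal part, symmetric term by term, and an off-diagonal part,
    symmetric after the two sums are exchanged because the weights are symmetric. *)
Lemma sym_bilinear_laplacian G :
  sym_bilinear (fun f g => dot (laplacian G f) g).
Proof.
have [[dC dP] _ _] := inner_product_dot R V.
split=> [f g|a f g h]; last by rewrite laplacian_is_linear dP.
have E f' g' : dot (laplacian G f') g' =
    \sum_x \sum_y G x y * (f' x * g' x) - \sum_x \sum_y G x y * (f' y * g' x).
  rewrite -sumrB; apply: eq_bigr => x _; rewrite ffunE mulr_suml -sumrB.
  by apply: eq_bigr => y _; ring.
rewrite !E; congr (_ - _).
  by apply: eq_bigr => x _; apply: eq_bigr => y _; rewrite [f x * _]mulrC.
rewrite exchange_big; apply: eq_bigr => x _; apply: eq_bigr => y _.
by rewrite weight_sym [f x * _]mulrC.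
Qed.

Lemma energyE G f : energy G f f = dot (laplacian G f) f.
Proof. by apply: eq_bigr => x _; rewrite mulrC. Qed.

(** Exchanging [x] and [y] in one of two copies of the energy completes the square; each edge is
    counted in both directions, hence the factor 2. Nonnegativity and the upper bound on the energy
    are read off from this form. *)
Lemma double_energy G f :
  2 * energy G f f = \sum_x \sum_y G x y * (f x - f y) ^+ 2.
Proof.
have E : energy G f f = \sum_x \sum_y G x y * (f x * (f x - f y)).
  apply: eq_bigr => x _; rewrite ffunE mulr_sumr.
  by apply: eq_bigr => y _; ring.
rewrite mulr_natl mulr2n E [X in X + _]exchange_big -big_split; apply: eq_bigr => x _.
rewrite -big_split; apply: eq_bigr => y _ /=.
by rewrite (weight_sym G y x); ring.
Qed.

Lemma energy_ge0 G f : 0 <= energy G f f.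
Proof.
rewrite -(pmulr_rge0 _ (x := 2)) // double_energy; apply: sumr_ge0 => x _.
by apply: sumr_ge0 => y _; rewrite mulr_ge0 ?weight_ge0 ?sqr_ge0.
Qed.

(** A crude constant that serves only to show that the suprema defining the operator norms are taken
    over bounded sets. *)
Definition total_weight G : R := \sum_x \sum_y G x y.

Lemma total_weight_ge0 G : 0 <= total_weight G.
Proof. by do 2![apply: sumr_ge0 => ? _]; apply: weight_ge0. Qed.

Lemma energy_le G f : energy G f f <= 2 * total_weight G * dot f f.
Proof.
have le_dot x : f x ^+ 2 <= dot f f.
  rewrite /dot (bigD1 x) //= expr2 lerDl.
  by apply: sumr_ge0 => y _; rewrite -expr2 sqr_ge0.
rewrite -(ler_pM2l (x := 2)) // double_energy.
have -> : 2 * (2 * total_weight G * dot f f) = total_weight G * (4 * dot f f).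
  by ring.
rewrite /total_weight mulr_suml; apply: ler_sum => x _.
rewrite mulr_suml; apply: ler_sum => y _.
apply: ler_wpM2l; first exact: weight_ge0.
(* [(f x - f y) ^+ 2] is at most [2 * f x ^+ 2 + 2 * f y ^+ 2], hence at most [4 * dot f f]. *)
have := le_dot x; have := le_dot y; have := sqr_ge0 (f x + f y).
by nra.
Qed.

Lemma laplacian_bounded G f :
  ip_norm dot (laplacian G f) <= 2 * total_weight G * ip_norm dot f.
Proof.
apply: (sym_op_bound (inner_product_dot R V)) (sym_bilinear_laplacian G) _ f.
  by rewrite mulr_ge0 ?total_weight_ge0.
by move=> g; rewrite -energyE ger0_norm ?energy_ge0 ?energy_le.
Qed.

End Laplacian.

(** * The Laplacian of a DC network on complex functions and its norm *)

Section ComplexLaplacian.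
Context {R : realType} {V : finType}.
Implicit Types (G : dc_network R V).

Definition re_part (f : scalar_fun V R[i]) : scalar_fun V R :=
  [ffun x => complex.Re (f x)].
Definition im_part (f : scalar_fun V R[i]) : scalar_fun V R :=
  [ffun x => complex.Im (f x)].
Definition cplx_of (f : scalar_fun V R) : scalar_fun V R[i] :=
  [ffun x => (f x)%:C].

Lemma Re_sum (I : finType) (F : I -> R[i]) :
  complex.Re (\sum_i F i) = \sum_i complex.Re (F i).
Proof. by apply: (big_morph (@complex.Re R)) => // -[? ?] [? ?]. Qed.

Lemma Im_sum (I : finType) (F : I -> R[i]) :
  complex.Im (\sum_i F i) = \sum_i complex.Im (F i).
Proof. by apply: (big_morph (@complex.Im R)) => // -[? ?] [? ?]. Qed.

Lemma norm2_cplxE f : norm2_cplx f =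
  Num.sqrt (dot (re_part f) (re_part f) + dot (im_part f) (im_part f)).
Proof.
rewrite /norm2_cplx /inner_cplx Re_sum -big_split; congr Num.sqrt.
by apply: eq_bigr => x _; rewrite !ffunE; case: (f x) => a b /=; ring.
Qed.

Lemma sqr_norm2_cplx f : norm2_cplx f ^+ 2 =
  ip_norm dot (re_part f) ^+ 2 + ip_norm dot (im_part f) ^+ 2.
Proof.
have [_ d0 _] := inner_product_dot R V.
by rewrite !(sqr_ip_norm (inner_product_dot R V)) norm2_cplxE sqr_sqrtr ?addr_ge0.
Qed.

Lemma re_part_laplacian G f :
  re_part (cplx_laplacian G f) = laplacian G (re_part f).
Proof.
apply/ffunP => x; rewrite !ffunE Re_sum; apply: eq_bigr => y _; rewrite !ffunE.
by case: (f x) (f y) => [? ?] [? ?] /=; ring.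
Qed.

Lemma im_part_laplacian G f :
  im_part (cplx_laplacian G f) = laplacian G (im_part f).
Proof.
apply/ffunP => x; rewrite !ffunE Im_sum; apply: eq_bigr => y _; rewrite !ffunE.
by case: (f x) (f y) => [? ?] [? ?] /=; ring.
Qed.

Lemma re_part_cplx_of f : re_part (cplx_of f) = f.
Proof. by apply/ffunP => x; rewrite !ffunE. Qed.

Lemma im_part_cplx_of f : im_part (cplx_of f) = 0.
Proof. by apply/ffunP => x; rewrite !ffunE. Qed.

Lemma norm2_cplx_cplx_of f : norm2_cplx (cplx_of f) = ip_norm dot f.
Proof.
rewrite norm2_cplxE re_part_cplx_of im_part_cplx_of.
by have [/bil0l -> _ _] := inner_product_dot R V; rewrite addr0.
Qed.

Lemma cplx_laplacian_cplx_of G f :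
  cplx_laplacian G (cplx_of f) = cplx_of (laplacian G f).
Proof.
apply/ffunP => x; rewrite !ffunE rmorph_sum /=; apply: eq_bigr => y _.
by rewrite !ffunE rmorphM rmorphB.
Qed.

(** [normL] is a supremum over complex functions, whereas the later estimates concern real ones. The
    embedding [cplx_of] is isometric and commutes with the Laplacian, so the complex norm also
    bounds the real operator. *)
Lemma normL_bound G : 0 <= normL G /\
  forall f, ip_norm dot (laplacian G f) <= normL G * ip_norm dot f.
Proof.
have dP := inner_product_dot R V; have [db d0 deq0] := dP.
have [| | | | | |n0 nT] := @op_norm_bound R R[i] (scalar_fun V R[i]) (real_complex R)
  (@norm2_cplx R V) (cplx_laplacian G) (2 * total_weight G).
- by move=> f; apply: sqrtr_ge0.
- move=> r f r0; rewrite !norm2_cplxE.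
  have -> : re_part (r%:C *: f) = r *: re_part f.
    apply/ffunP => x; rewrite !ffunE; case: (f x) => a b.
    by rewrite /= /GRing.scale /=; ring.
  have -> : im_part (r%:C *: f) = r *: im_part f.
    apply/ffunP => x; rewrite !ffunE; case: (f x) => a b.
    by rewrite /= /GRing.scale /=; ring.
  rewrite !(bilZl db, bilZr db) !mulrA -mulrDr -expr2 sqrtrM ?sqr_ge0 //.
  by rewrite sqrtr_sqr ger0_norm.
- move=> f f0; have /eqP := sqr_norm2_cplx f.
  rewrite f0 expr0n eq_sym paddr_eq0 ?sqr_ge0 // !sqrf_eq0.
  move=> /andP[/eqP/(ip_norm_eq0 dP)/ffunP re0 /eqP/(ip_norm_eq0 dP)/ffunP im0].
  apply/ffunP => x; have := re0 x; have := im0 x; rewrite !ffunE.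
  by case: (f x) => a b /= -> ->.
- have -> : 0 = cplx_of 0 by apply/ffunP => x; rewrite !ffunE.
  by rewrite norm2_cplx_cplx_of /ip_norm (bil0l db) sqrtr0.
- have K0 : 0 <= 2 * total_weight G by rewrite mulr_ge0 ?total_weight_ge0.
  move=> f; rewrite -(ler_pXn2r (n := 2)) ?nnegrE ?(mulr_ge0 K0) ?sqrtr_ge0 //.
  (* The weights are real, so the Laplacian acts separately on real and imaginary parts; the two
     squared real bounds add up to the complex one. *)
  rewrite exprMn !sqr_norm2_cplx mulrDr re_part_laplacian im_part_laplacian.
  rewrite -!exprMn; apply: lerD;
    rewrite ler_pXn2r ?nnegrE ?mulr_ge0 ?ip_norm_ge0 ?total_weight_ge0 //;
  exact: laplacian_bounded.
- by rewrite mulr_ge0 ?total_weight_ge0.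
split=> // f; rewrite -!norm2_cplx_cplx_of -cplx_laplacian_cplx_of.
exact: nT.
Qed.

End ComplexLaplacian.

(** * Multiplication, Laplacian and [Qop] on vector functions *)

Section VectorOperators.
Context {R : realType} {V : finType} {m : nat}.
Implicit Types (G : dc_network R V) (v w : vector_fun V R m).

Local Notation vnorm := (ip_norm (@inner_real R V m)).

Definition hadamard w v : vector_fun V R m :=
  [ffun x => \row_j (w x 0 j * v x 0 j)].

Definition vlaplacian (a : V -> V -> R) v : vector_fun V R m :=
  [ffun x => \row_j laplacian a (component v j) x].

Lemma component_hadamard w v j :
  component (hadamard w v) j = pmul (component w j) (component v j).
Proof. by apply/ffunP => x; rewrite !ffunE mxE. Qed.

Lemma component_vlaplacian (a : V -> V -> R) v j :
  component (vlaplacian a v) j = laplacian a (component v j).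
Proof. by apply/ffunP => x; rewrite [LHS]ffunE [vlaplacian _ _ _]ffunE mxE. Qed.

Lemma QopE G w v : Qop G w v = hadamard w (vlaplacian G (hadamard w v)).
Proof.
apply/ffunP => x; apply/rowP => j; rewrite ffunE mxE.
rewrite [hadamard _ _ _ in RHS]ffunE mxE [vlaplacian _ _ _]ffunE mxE component_hadamard.
by rewrite /pmul ffunE [component w j x]ffunE.
Qed.

Lemma dot_pmull (f g h : scalar_fun V R) : dot (pmul f g) h = dot g (pmul f h).
Proof. by apply: eq_bigr => x _; rewrite !ffunE; ring. Qed.

(** Pointwise multiplication by [w] is self-adjoint and can be moved to the other side. The
    quadratic form of [Qop G w] is thus a sum of energies, through which it inherits symmetry,
    positivity and approximation from the Laplacian. *)
Lemma inner_real_Qop G w v v' : inner_real (Qop G w v) v' =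
  \sum_(j < m) dot (laplacian G (pmul (component w j) (component v j)))
                   (pmul (component w j) (component v' j)).
Proof.
rewrite QopE inner_real_dot; apply: eq_bigr => j _.
by rewrite component_hadamard component_vlaplacian component_hadamard dot_pmull.
Qed.

Lemma pmulDr (f g h : scalar_fun V R) (a : R) :
  pmul f (a *: g + h) = a *: pmul f g + pmul f h.
Proof.
by apply/ffunP => x; rewrite !ffunE /GRing.scale /=; ring.
Qed.

Lemma sym_bilinear_Qop G w :
  sym_bilinear (fun v v' => inner_real (Qop G w v) v').
Proof.
have [lC lP] := sym_bilinear_laplacian G.
split=> [v v'|a v v' v'']; rewrite !inner_real_Qop.
  by apply: eq_bigr => j _; rewrite lC.
rewrite mulr_sumr -big_split; apply: eq_bigr => j _ /=.
by rewrite component_linear pmulDr lP.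
Qed.

Lemma inner_real_Qop_ge0 G w v : 0 <= inner_real (Qop G w v) v.
Proof.
rewrite inner_real_Qop; apply: sumr_ge0 => j _.
by rewrite -energyE energy_ge0.
Qed.

Lemma norm_inf_ge0 w : 0 <= norm_inf w.
Proof. exact: bigmax_ge_id. Qed.

Lemma le_norm_inf w j x : `|component w j x| <= norm_inf w.
Proof.
rewrite /norm_inf; apply: le_trans (le_bigmax _ _ j).
exact: (le_bigmax _ (fun x => `|component w j x|) x).
Qed.

Lemma dot_pmul_le w v j :
  dot (pmul (component w j) (component v j)) (pmul (component w j) (component v j))
  <= norm_inf w ^+ 2 * dot (component v j) (component v j).
Proof.
rewrite /dot mulr_sumr; apply: ler_sum => x _.
rewrite [pmul _ _ _]ffunE mulrACA -!expr2 ler_wpM2r ?sqr_ge0 //.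
by rewrite -[leLHS]real_normK ?num_real // ler_pXn2r ?nnegrE ?norm_inf_ge0 ?le_norm_inf.
Qed.

Lemma hadamard_bound w v :
  vnorm (hadamard w v) <= norm_inf w * vnorm v.
Proof.
rewrite -(ler_pXn2r (n := 2)) ?nnegrE ?mulr_ge0 ?ip_norm_ge0 ?norm_inf_ge0 //.
rewrite exprMn !(sqr_ip_norm (inner_product_inner_real R V m)) !inner_real_dot.
rewrite mulr_sumr; apply: ler_sum => j _.
by rewrite component_hadamard dot_pmul_le.
Qed.

(** The a priori constant combines [energy_le] with the fact that multiplication by [w] enlarges
    squared norms by at most [norm_inf w ^+ 2]. *)
Lemma normQ_bound G w : 0 <= normQ G w /\
  forall v, vnorm (Qop G w v) <= normQ G w * vnorm v.
Proof.
have iP := inner_product_inner_real R V m; have [ib i0 ieq0] := iP.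
have K0 : 0 <= 2 * total_weight G * norm_inf w ^+ 2.
  by rewrite !mulr_ge0 ?total_weight_ge0 ?norm_inf_ge0.
apply: (@op_norm_bound R R _ id (vnorm) (Qop G w)
  (2 * total_weight G * norm_inf w ^+ 2)) => //.
- by move=> v; apply: sqrtr_ge0.
- by move=> r v; apply: ip_normZ.
- exact: ip_norm_eq0.
- by rewrite /ip_norm (bil0l ib) sqrtr0.
apply: sym_op_bound => //; first exact: sym_bilinear_Qop.
move=> v; rewrite ger0_norm ?inner_real_Qop_ge0 // inner_real_Qop.
rewrite inner_real_dot mulr_sumr; apply: ler_sum => j _.
rewrite -energyE; apply: le_trans (energy_le _ _) _.
by rewrite -[leRHS]mulrA ler_wpM2l ?dot_pmul_le // mulr_ge0 ?total_weight_ge0.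
Qed.

(** * Operator changes under approximation of a DC network *)

Section Approximation.
Context {eps : R} {G G' : dc_network R V}.
Hypotheses (eps_gt0 : 0 < eps) (GG' : dc_approx eps G' G).

(** The approximation hypothesis, tested on the products of the components of [w] and of [f] and
    summed over components, compares the two quadratic forms as [approx_op_bound] requires. *)
Lemma Qop_approx w v : vnorm (Qop G' w v - Qop G w v) <=
  eps * normQ G w * vnorm v.
Proof.
have [n0 nQ] := normQ_bound G w.
apply: (approx_op_bound (inner_product_inner_real R V m) (Qop G w) (Qop G' w)) => //.
- exact: sym_bilinear_Qop.
- exact: sym_bilinear_Qop.
- exact: inner_real_Qop_ge0.
move=> f; rewrite !inner_real_Qop !mulr_sumr.
by split; apply: ler_sum => j _; rewrite -!energyE;
  have [] := GG' (pmul (component w j) (component f j)).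
Qed.

Lemma laplacian_approx f : ip_norm dot (laplacian G' f - laplacian G f) <=
  eps * normL G * ip_norm dot f.
Proof.
have [n0 nL] := normL_bound G.
apply: (approx_op_bound (inner_product_dot R V) (laplacian G) (laplacian G')) => //.
- exact: sym_bilinear_laplacian.
- exact: sym_bilinear_laplacian.
- by move=> g; rewrite -energyE energy_ge0.
by move=> g; rewrite -!energyE.
Qed.

(** The scalar bound has the same constant for every component, so its squares can be summed. *)
Lemma vlaplacian_approx v :
  vnorm (vlaplacian G' v - vlaplacian G v) <=
  eps * normL G * vnorm v.
Proof.
have dP := inner_product_dot R V; have iP := inner_product_inner_real R V m.
have [n0 _] := normL_bound G.
have e0 : 0 <= eps * normL G by rewrite mulr_ge0 // ltW.
rewrite -(ler_pXn2r (n := 2)) ?nnegrE ?(mulr_ge0 e0) ?ip_norm_ge0 // exprMn.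
rewrite !(sqr_ip_norm iP) !inner_real_dot mulr_sumr; apply: ler_sum => j _.
have -> : component (vlaplacian G' v - vlaplacian G v) j =
    laplacian G' (component v j) - laplacian G (component v j).
  by rewrite addrC -scaleN1r component_linear scaleN1r !component_vlaplacian addrC.
rewrite -!(sqr_ip_norm dP) -exprMn ler_pXn2r ?nnegrE ?(mulr_ge0 e0) ?ip_norm_ge0 //.
exact: laplacian_approx.
Qed.

Lemma hadamard_vlaplacian_approx w v :
  vnorm (hadamard w (vlaplacian G' v - vlaplacian G v)) <=
  eps * (normL G * (norm_inf w * norm2_real v)).
Proof.
apply: le_trans (hadamard_bound _ _) _.
apply: le_trans (ler_wpM2l (norm_inf_ge0 w) (vlaplacian_approx v)) _.
by rewrite mulrCA !mulrA.
Qed.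

End Approximation.

End VectorOperators.

(** * The residual of an AC network and its real and imaginary parts *)

Section Mismatch.
Context {R : realType} {V : finType} {m : nat}.
Implicit Types (G : ac_network R V) (u s : vector_fun V R[i] m).
Local Notation vnorm := (ip_norm (@inner_real R V m)).
Local Notation normc := ComplexField.Normc.normc.

Definition mismatch G u s : vector_fun V R[i] m :=
  [ffun x => \row_j
    (component u j x * conjc (laplacian (admittance G) (component u j) x)
     - component s j x)].

(** Writing the error as the modulus of a complex number, whose coordinates are the norms of the two
    parts of the residual, lets these parts be estimated separately and recombined by the triangle
    inequality in the plane. *)
Lemma rmsE G u s : rms G u s = (Num.sqrt (2 * m%:R * #|V|%:R))^-1 *
  normc (vnorm (re_fun (mismatch G u s)) +i* vnorm (im_fun (mismatch G u s))).
Proof.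
have iP := inner_product_inner_real R V m.
have c0 : 0 <= 2 * m%:R * #|V|%:R :> R by rewrite !mulr_ge0 ?ler0n.
rewrite /rms [LHS]sqrtrM ?invr_ge0 // -sqrtrV //.
congr (_ * Num.sqrt _); rewrite !(sqr_ip_norm iP) !inner_real_dot -big_split.
apply: eq_bigr => j _; rewrite -big_split; apply: eq_bigr => x _ /=.
have -> : component (re_fun (mismatch G u s)) j x =
    complex.Re (mismatch G u s x 0 j) by rewrite 2!ffunE mxE.
have -> : component (im_fun (mismatch G u s)) j x =
    complex.Im (mismatch G u s x 0 j) by rewrite 2!ffunE mxE.
rewrite [mismatch G u s x]ffunE mxE -!expr2.
by case: (_ - _) => a b; rewrite sqr_sqrtr ?addr_ge0 ?sqr_ge0.
Qed.

Lemma laplacian_admittance G u j x :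
  laplacian (admittance G) (component u j) x =
  (laplacian (conductance G) (component (re_fun u) j) x +
   laplacian (susceptance G) (component (im_fun u) j) x) +i*
  (laplacian (conductance G) (component (im_fun u) j) x -
   laplacian (susceptance G) (component (re_fun u) j) x).
Proof.
apply/eqP; rewrite eq_complex /= !ffunE Re_sum Im_sum -big_split -sumrB /=.
by apply/andP; split; apply/eqP; apply: eq_bigr => y _; rewrite !ffunE !mxE;
  case: (u x 0 j) (u y 0 j) => [? ?] [? ?] /=; ring.
Qed.

Lemma mismatch_entry G u s x j :
  let p := component (re_fun u) j in let q := component (im_fun u) j in
  let Lc := laplacian (conductance G) in let Lb := laplacian (susceptance G) in
  mismatch G u s x 0 j =
  (p x * Lc p x + p x * Lb q x + q x * Lc q x - q x * Lb p x
   - component (re_fun s) j x) +i*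
  (q x * Lc p x + q x * Lb q x - p x * Lc q x + p x * Lb p x
   - component (im_fun s) j x).
Proof.
move=> p q Lc Lb; rewrite [mismatch G u s x]ffunE mxE laplacian_admittance.
have E (f : vector_fun V R[i] m) : component f j x =
    component (re_fun f) j x +i* component (im_fun f) j x.
  by rewrite !ffunE !mxE; case: (f x 0 j).
rewrite !E -/p -/q -/Lc -/Lb.
by apply/eqP; rewrite eq_complex /=; apply/andP; split; apply/eqP; ring.
Qed.

Lemma vector_funD (f g : vector_fun V R m) x j :
  (f + g) x 0 j = f x 0 j + g x 0 j.
Proof. by rewrite ffunE mxE. Qed.

Lemma vector_funN (f : vector_fun V R m) x j : (- f) x 0 j = - f x 0 j.
Proof. by rewrite ffunE mxE. Qed.

Definition ones : vector_fun V R m := [ffun x => const_mx 1].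

Lemma vnorm_ones : vnorm ones = Num.sqrt (m%:R * #|V|%:R).
Proof.
rewrite /ip_norm inner_real_dot -natrM; congr Num.sqrt.
rewrite (eq_bigr (fun=> #|V|%:R)) ?sumr_const ?card_ord -?natrM ?mulr_natl.
  by rewrite -mulrnA mulnC.
move=> j _; rewrite /dot (eq_bigr (fun=> 1)) ?sumr_const //.
by move=> x _; rewrite !ffunE !mxE mulr1.
Qed.

Definition Qop_change (a a' : dc_network R V) (w : vector_fun V R m) :
    vector_fun V R m :=
  Qop a' w ones - Qop a w ones.

Definition cross_change (a a' : dc_network R V) (w v : vector_fun V R m) :
    vector_fun V R m :=
  hadamard w (vlaplacian a' v - vlaplacian a v).

Lemma Qop_ones_entry (a : dc_network R V) (w : vector_fun V R m) x j :
  Qop a w ones x 0 j = component w j x * laplacian a (component w j) x.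
Proof.
rewrite ffunE mxE [LHS]ffunE; congr (_ * laplacian _ _ _).
by apply/ffunP => y; rewrite !ffunE !mxE mulr1.
Qed.

Lemma Qop_change_entry (a a' : dc_network R V) (w : vector_fun V R m) x j :
  Qop_change a a' w x 0 j =
  component w j x * laplacian a' (component w j) x
  - component w j x * laplacian a (component w j) x.
Proof. by rewrite vector_funD vector_funN !Qop_ones_entry. Qed.

Lemma cross_change_entry (a a' : dc_network R V) (w v : vector_fun V R m) x j :
  cross_change a a' w v x 0 j =
  component w j x * laplacian a' (component v j) x
  - component w j x * laplacian a (component v j) x.
Proof.
have E b : laplacian b (component v j) x = vlaplacian b v x 0 j.
  by rewrite -component_vlaplacian [LHS]ffunE.
rewrite -mulrBr !E [component w j x]ffunE [LHS](_ : _ = w x 0 j *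
  (vlaplacian a' v - vlaplacian a v) x 0 j); last first.
  by rewrite [cross_change _ _ _ _ x]ffunE mxE.
by rewrite vector_funD vector_funN.
Qed.

Lemma vnormN (v : vector_fun V R m) : vnorm (- v) = vnorm v.
Proof.
have [ib _ _] := inner_product_inner_real R V m.
by rewrite -scaleN1r /ip_norm (bilZl ib) (bilZr ib) !mulN1r opprK.
Qed.

(** The networks [a] and [b] are left abstract so that one estimate covers both parts of the
    residual: [a] is the conductance network for the real part and the susceptance network for the
    imaginary part. *)
Lemma vnorm_change_le (eps : R) (a a' b b' : dc_network R V)
    (M p q w v : vector_fun V R m) :
  0 < eps -> dc_approx eps a' a -> dc_approx eps b' b ->
  vnorm (M + (Qop_change a a' p + Qop_change a a' q +
              (cross_change b b' w v - cross_change b b' v w))) <=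
  vnorm M + eps *
    (Num.sqrt (m%:R * #|V|%:R) * (normQ a p + normQ a q) +
     normL b * (norm_inf w * norm2_real v + norm_inf v * norm2_real w)).
Proof.
move=> eps0 approx_a approx_b.
have iP := inner_product_inner_real R V m.
have Q_le z : vnorm (Qop_change a a' z) <=
    eps * (Num.sqrt (m%:R * #|V|%:R) * normQ a z).
  apply: le_trans (Qop_approx eps0 approx_a z ones) _.
  by rewrite vnorm_ones -mulrA [normQ _ _ * _]mulrC.
apply: le_trans (ip_normD iP _ _) _; rewrite lerD2l.
apply: le_trans (ip_normD iP _ _) _.
apply: le_trans (lerD (ip_normD iP _ _) (ip_normD iP _ _)) _; rewrite vnormN.
rewrite !mulrDr.
apply: lerD; apply: lerD; try exact: Q_le;
  exact: hadamard_vlaplacian_approx.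
Qed.

(** * Change of the residual under approximation of an AC network *)

Section Approximation.
Context {eps : R} {G G' : ac_network R V}.
Hypotheses (eps_gt0 : 0 < eps) (GG' : ac_approx eps G' G).

(** The datum [s] enters both residuals identically, so the change involves [u] alone; this is why
    [Delta] does not depend on [s]. *)
Lemma re_mismatch_change u s :
  let p := re_fun u in let q := im_fun u in
  re_fun (mismatch G' u s) = re_fun (mismatch G u s) +
    (Qop_change (conductance G) (conductance G') p +
     Qop_change (conductance G) (conductance G') q +
     (cross_change (susceptance G) (susceptance G') p q -
      cross_change (susceptance G) (susceptance G') q p)).
Proof.
move=> p q; apply/ffunP => x; apply/rowP => j.
rewrite 3!vector_funD !Qop_change_entry.
rewrite vector_funD vector_funN !cross_change_entry.
have E H : re_fun (mismatch H u s) x 0 j =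
    component p j x * laplacian (conductance H) (component p j) x
    + component p j x * laplacian (susceptance H) (component q j) x
    + component q j x * laplacian (conductance H) (component q j) x
    - component q j x * laplacian (susceptance H) (component p j) x
    - component (re_fun s) j x.
  by rewrite ffunE mxE mismatch_entry.
rewrite [LHS]E [X in _ = X + _]E.
(* Four DC networks acting on [p] and [q] give eight Laplacian values; with these as unknowns a
   polynomial identity remains. *)
do 8![move: (laplacian _ _ x) => ?].
by move: (component p j x) (component q j x) (component _ j x) => ? ? ?; ring.
Qed.

(** Compared with the real part, conductance and susceptance exchange roles, and the cross terms
    appear with [p] and [q] interchanged. *)
Lemma im_mismatch_change u s :
  let p := re_fun u in let q := im_fun u in
  im_fun (mismatch G' u s) = im_fun (mismatch G u s) +
    (Qop_change (susceptance G) (susceptance G') p +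
     Qop_change (susceptance G) (susceptance G') q +
     (cross_change (conductance G) (conductance G') q p -
      cross_change (conductance G) (conductance G') p q)).
Proof.
move=> p q; apply/ffunP => x; apply/rowP => j.
rewrite 3!vector_funD !Qop_change_entry.
rewrite vector_funD vector_funN !cross_change_entry.
have E H : im_fun (mismatch H u s) x 0 j =
    component q j x * laplacian (conductance H) (component p j) x
    + component q j x * laplacian (susceptance H) (component q j) x
    - component p j x * laplacian (conductance H) (component q j) x
    + component p j x * laplacian (susceptance H) (component p j) x
    - component (im_fun s) j x.
  by rewrite ffunE mxE mismatch_entry.
rewrite [LHS]E [X in _ = X + _]E.
do 8![move: (laplacian _ _ x) => ?].
by move: (component p j x) (component q j x) (component _ j x) => ? ? ?; ring.
Qed.

Lemma re_mismatch_le u s : vnorm (re_fun (mismatch G' u s)) <=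
  vnorm (re_fun (mismatch G u s)) + eps * DeltaA G u.
Proof.
have [approx_c approx_b] := GG'.
rewrite [X in vnorm X <= _]re_mismatch_change.
exact: (vnorm_change_le _ _ _ _ _ _ _ _ _ _ eps_gt0 approx_c approx_b).
Qed.

Lemma im_mismatch_le u s : vnorm (im_fun (mismatch G' u s)) <=
  vnorm (im_fun (mismatch G u s)) + eps * DeltaB G u.
Proof.
have [approx_c approx_b] := GG'.
rewrite [X in vnorm X <= _]im_mismatch_change.
exact: (vnorm_change_le _ _ _ _ _ _ _ _ _ _ eps_gt0 approx_b approx_c).
Qed.

End Approximation.

End Mismatch.

Theorem theorem5p4 (R : realType) (V : finType) (hV : (0 < #|V|)%N)
    (G : ac_network R V) (m : nat) (hm : (1 <= m)%N)
    (u s : vector_fun V R[i] m) (eps : R) (heps : 0 < eps)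
    (G' : ac_network R V) (happrox : ac_approx eps G' G) :
  rms G' u s <=
    rms G u s + eps * (Delta G u / Num.sqrt (2 * m%:R * #|V|%:R)).
Proof.
rewrite !rmsE mulrA [eps * _ / _]mulrC -mulrDr.
apply: ler_wpM2l; first by rewrite invr_ge0 sqrtr_ge0.
have reP := re_mismatch_le heps happrox u s.
have imP := im_mismatch_le heps happrox u s.
have -> : eps * Delta G u =
    ComplexField.Normc.normc ((eps * DeltaA G u) +i* (eps * DeltaB G u)).
  by rewrite /Delta /= !exprMn -mulrDr sqrtrM ?sqr_ge0 // sqrtr_sqr gtr0_norm.
(* The triangle inequality for the modulus splits off the point with coordinates [eps * DeltaA G u]
   and [eps * DeltaB G u]; what remains is monotonicity of the modulus in nonnegative
   coordinates. *)
apply: le_trans _ (le_normcD _ _) => /=.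
apply: ler_wsqrtr; apply: lerD;
  by rewrite ler_pXn2r ?nnegrE ?ip_norm_ge0 ?(le_trans _ reP)
    ?(le_trans _ imP) ?ip_norm_ge0.
Qed.
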